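(* Let $c>0$. Let $L:\mathbb{R}_+\times[0,c)\to\mathbb{R}_+$ be a surjective function satisfying the basic hypotheses (defined in the context), and let $\oplus:[0,c)\times[0,c)\to[0,c)$ be an operation which is continuous and strictly increasing in both variables and which has $0$ as its identity element. Suppose that $L$ satisfies the Lorentz-FitzGerald Contraction $$L(\lambda,v)=\lambda\sqrt{1-\left(\frac vc\right)^2}\qquad(\lambda\in\mathbb{R}_+,\ v\in[0,c)).$$ Then the following three conditions are equivalent: [M] For all $\lambda,\lambda'\in\mathbb{R}_+$ and $v,v',w\in[0,c)$: $L(\lambda,v)\le L(\lambda',v')$ if and only if $L(\lambda,v\oplus w)\le L(\lambda',v'\oplus w)$. [A$^\star$] For all $v,w\in[0,c)$: $$v\oplus w=c\,\sqrt{\left(\frac vc\right)^2+\left(\frac wc\right)^2-\left(\frac wc\right)^2\left(\frac vc\right)^2}.$$ [R] For all $\lambda\in\mathbb{R}_+$ and $v,w\in[0,c)$: $L(L(\lambda,v),w)=L(\lambda,v\oplus w)$.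
   Context: $\mathbb{R}_+$ denotes the set of strictly positive real numbers. A surjective function $L:\mathbb{R}_+\times[0,c)\to\mathbb{R}_+$ satisfies the \emph{basic hypotheses} if: (1) $L$ is strictly increasing in the first variable, strictly decreasing in the second variable, and continuous in both variables; (2) $L$ satisfies left order-invariance with respect to similarity transformations [LOI]: for all $x,z\in\mathbb{R}_+$, all $a>0$ and all $y,w\in[0,c)$, $L(x,y)\le L(z,w)$ if and only if $L(ax,y)\le L(az,w)$; (3) $L(\lambda,0)=\lambda$ for all $\lambda\in\mathbb{R}_+$. An operation $\oplus$ on $[0,c)$ has $0$ as its identity element if $0\oplus v=v\oplus 0=v$ for all $v\in[0,c)$. *)

(* Defs.v *)
From HB Require Import structures.
From mathcomp Require Import all_boot all_order all_algebra.
From mathcomp Require Import all_classical all_reals all_analysis.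
Set Implicit Arguments.
Unset Strict Implicit.
Unset Printing Implicit Defensive.
Import Order.TTheory GRing.Theory Num.Theory numFieldNormedType.Exports.
Local Open Scope classical_set_scope.
Local Open Scope ring_scope.

(* Functions on R_+ x [0, c) and on [0, c) x [0, c) are represented by total
   functions R -> R -> R; every condition below constrains only their values on
   the intended domain.  "Continuous in both variables" is continuity in each
   variable separately, for the topology of the domain; for functions that are
   strictly monotone in each variable, as here, this is the same as joint
   continuity. *)

Definition posreals (R : realType) : set R := [set` `]0, +oo[].

Definition velocities (R : realType) (c : R) : set R := [set` `[0, c[].

Record basic_hypotheses (R : realType) (c : R) (L : R -> R -> R) : Prop :=
  BasicHypotheses {
  basic_increasing : forall x y v, posreals x -> posreals y ->
    velocities c v -> x < y -> L x v < L y v;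
  basic_decreasing : forall x v w, posreals x ->
    velocities c v -> velocities c w -> v < w -> L x w < L x v;
  basic_continuous_l : forall v, velocities c v ->
    {within @posreals R, continuous (fun x => L x v)};
  basic_continuous_r : forall x, posreals x ->
    {within velocities c, continuous (fun v => L x v)};
  basic_LOI : forall x z a y w, posreals x -> posreals z -> 0 < a ->
    velocities c y -> velocities c w ->
    (L x y <= L z w <-> L (a * x) y <= L (a * z) w);
  basic_at_rest : forall x, posreals x -> L x 0 = x }.

Record velocity_operation (R : realType) (c : R) (op : R -> R -> R) : Prop :=
  VelocityOperation {
  velop_closed : forall v w, velocities c v -> velocities c w ->
    velocities c (op v w);
  velop_increasing_l : forall v v' w, velocities c v -> velocities c v' ->
    velocities c w -> v < v' -> op v w < op v' w;
  velop_increasing_r : forall v w w', velocities c v -> velocities c w ->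
    velocities c w' -> w < w' -> op v w < op v w';
  velop_continuous_l : forall w, velocities c w ->
    {within velocities c, continuous (fun v => op v w)};
  velop_continuous_r : forall v, velocities c v ->
    {within velocities c, continuous (fun w => op v w)};
  velop_id_l : forall v, velocities c v -> op 0 v = v;
  velop_id_r : forall v, velocities c v -> op v 0 = v }.

Definition LorentzFitzGerald (R : realType) (c : R) (L : R -> R -> R) : Prop :=
  forall x v, posreals x -> velocities c v ->
    L x v = x * Num.sqrt (1 - (v / c) ^+ 2).

Definition condM (R : realType) (c : R) (L op : R -> R -> R) : Prop :=
  forall x x' v v' w, posreals x -> posreals x' ->
    velocities c v -> velocities c v' -> velocities c w ->
    (L x v <= L x' v' <-> L x (op v w) <= L x' (op v' w)).

Definition condAstar (R : realType) (c : R) (op : R -> R -> R) : Prop :=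
  forall v w, velocities c v -> velocities c w ->
    op v w =
    c * Num.sqrt ((v / c) ^+ 2 + (w / c) ^+ 2 - (w / c) ^+ 2 * (v / c) ^+ 2).

Definition condR (R : realType) (c : R) (L op : R -> R -> R) : Prop :=
  forall x v w, posreals x -> velocities c v -> velocities c w ->
    L (L x v) w = L x (op v w).

(* Main.v *)
(* With g v = sqrt (1 - (v/c)^2), so that L x v = x * g v, each of [M],
   [A*] and [R] is equivalent to g (v (+) w) = g v * g w.  For [M], compare
   L x v with the object of length x * g v at rest: these have equal apparent
   lengths, and stay so after adding w because 0 (+) w = w. *)
Require Import Defs.
From HB Require Import structures.
From mathcomp Require Import all_boot all_order all_algebra.
From mathcomp Require Import all_classical all_reals all_analysis.
From mathcomp Require Import ring lra.
Set Implicit Arguments.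
Unset Strict Implicit.
Unset Printing Implicit Defensive.
Import Order.TTheory GRing.Theory Num.Theory numFieldNormedType.Exports.
Local Open Scope classical_set_scope.
Local Open Scope ring_scope.

(** The reciprocal of the Lorentz factor at speed [v]. *)
Definition contraction (R : realType) (c v : R) : R := Num.sqrt (1 - (v / c) ^+ 2).

Definition contraction_multiplicative (R : realType) (c : R) (op : R -> R -> R) : Prop :=
  forall v w, velocities c v -> velocities c w ->
    contraction c (op v w) = contraction c v * contraction c w.

Lemma posrealsE (R : realType) (x : R) : posreals x = (0 < x) :> Prop.
Proof. by rewrite /posreals /= in_itv /= andbT. Qed.

Lemma velocitiesE (R : realType) (c v : R) : velocities c v = (0 <= v < c) :> Prop.
Proof. by rewrite /velocities /= in_itv. Qed.

Lemma subr_sqr_ratio_gt0 (R : realType) (c v : R) :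
  velocities c v -> 0 < 1 - (v / c) ^+ 2.
Proof.
rewrite velocitiesE => /andP[v0 vc]; have c0 : 0 < c by exact: le_lt_trans vc.
by rewrite subr_gt0 expr_lt1 ?(divr_ge0 v0 (ltW c0))// ltr_pdivrMr// mul1r.
Qed.

Lemma contraction_gt0 (R : realType) (c v : R) :
  velocities c v -> 0 < contraction c v.
Proof. by move=> hv; rewrite sqrtr_gt0 subr_sqr_ratio_gt0. Qed.

Lemma sqr_contraction (R : realType) (c v : R) :
  velocities c v -> contraction c v ^+ 2 = 1 - (v / c) ^+ 2.
Proof. by move=> hv; rewrite sqr_sqrtr// ltW// subr_sqr_ratio_gt0. Qed.

Lemma contraction0 (R : realType) (c : R) : contraction c 0 = 1.
Proof. by rewrite /contraction mul0r expr0n subr0 sqrtr1. Qed.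

(** With [a = (v / c) ^+ 2] and [b = (w / c) ^+ 2], the radicand in [A*] satisfies
    [1 - (a + b - b * a) = (1 - a) * (1 - b)]; the two conditions differ only by taking squares or
    square roots of nonnegative numbers. *)
Lemma condAstar_multiplicative (R : realType) (c : R) (op : R -> R -> R) :
  0 < c ->
  (forall v w, velocities c v -> velocities c w -> velocities c (op v w)) ->
  condAstar c op <-> contraction_multiplicative c op.
Proof.
move=> c0 opc; have cn0 : c != 0 by rewrite gt_eqF.
split=> H v w hv hw.
- have gv := subr_sqr_ratio_gt0 hv; have gw := subr_sqr_ratio_gt0 hw.
  rewrite {1}/contraction H// [c * _]mulrC mulfK// sqr_sqrtr.
    by rewrite -sqrtrM ?ltW//; congr Num.sqrt; ring.
  (* The radicand is nonnegative because it equals [a + b * (1 - a)] with [0 <= a < 1] and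
     [0 <= b]. *)
  have := sqr_ge0 (v / c); have := sqr_ge0 (w / c); nra.
- have /eqP := congr1 (fun x => x ^+ 2) (H _ _ hv hw).
  rewrite exprMn !sqr_contraction//; last exact: opc.
  move=> /eqP E.
  have -> : (v / c) ^+ 2 + (w / c) ^+ 2 - (w / c) ^+ 2 * (v / c) ^+ 2
          = (op v w / c) ^+ 2 by lra.
  (* Closure of [0, c) under [op] gives the sign that selects the nonnegative root. *)
  have /andP[vw_ge0 _] : 0 <= op v w < c by rewrite -velocitiesE; exact: opc.
  by rewrite sqrtr_sqr ger0_norm ?(divr_ge0 vw_ge0 (ltW c0))// mulrC divfK.
Qed.

(** Applying [L] twice multiplies the length by two contraction factors; the length 1 already
    isolates them. *)
Lemma condR_multiplicative (R : realType) (c : R) (L op : R -> R -> R) :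
  (forall x v, posreals x -> velocities c v -> posreals (L x v)) ->
  (forall v w, velocities c v -> velocities c w -> velocities c (op v w)) ->
  LorentzFitzGerald c L ->
  condR c L op <-> contraction_multiplicative c op.
Proof.
move=> Lpos opc LF; have p1 : posreals (1 : R) by rewrite posrealsE.
split=> [H v w hv hw|H x v w hx hv hw].
- have := H 1 v w p1 hv hw.
  rewrite !LF ?mul1r//; first exact: opc.
  (* The intermediate length is positive because it is [L 1 v]. *)
  by rewrite -(mul1r (Num.sqrt _)) -LF//; exact: Lpos.
- rewrite (LF _ _ (Lpos _ _ hx hv) hw) !LF//; last exact: opc.
  by rewrite -!/(contraction _ _) H// mulrA.
Qed.

(** For the converse direction, multiplicativity makes adding [w] scale both apparent lengths by the
    same positive factor [contraction c w], which preserves and reflects their order. *)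
Lemma condM_multiplicative (R : realType) (c : R) (L op : R -> R -> R) :
  (forall v w, velocities c v -> velocities c w -> velocities c (op v w)) ->
  (forall v, velocities c v -> op 0 v = v) ->
  LorentzFitzGerald c L ->
  condM c L op <-> contraction_multiplicative c op.
Proof.
move=> opc op0 LF; have p1 : posreals (1 : R) by rewrite posrealsE.
split=> [H v w hv hw|H x x' v v' w hx hx' hv hv' hw].
- have v0 : velocities c 0.
    by move: hv; rewrite !velocitiesE lexx => /andP[]; exact: le_lt_trans.
  have pv : posreals (contraction c v) by rewrite posrealsE contraction_gt0.
  have E : L 1 v = L (contraction c v) 0.
    by rewrite !LF// -!/(contraction _ _) contraction0 mul1r mulr1.
  have : L 1 (op v w) = L (contraction c v) (op 0 w).
    (* [M] transports only inequalities, so the equality [E] is carried over as two of them. *)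
    apply/eqP; rewrite eq_le; apply/andP; split.
      by apply/(H _ _ _ _ _ p1 pv hv v0 hw); rewrite E.
    by apply/(H _ _ _ _ _ pv p1 v0 hv hw); rewrite E.
  by rewrite op0// !LF ?mul1r//; exact: opc.
- rewrite !LF//; [|exact: opc|exact: opc].
  rewrite -!/(contraction _ _) !H// !mulrA.
  by rewrite ler_pM2r// contraction_gt0.
Qed.

Theorem corollary9 (R : realType) (c : R) (L op : R -> R -> R)
    (c_gt0 : 0 < c)
    (L_fun : forall x v, posreals x -> velocities c v -> posreals (L x v))
    (L_surj : forall y, posreals y ->
       exists x v, [/\ posreals x, velocities c v & L x v = y])
    (L_basic : basic_hypotheses c L)
    (op_vel : velocity_operation c op)
    (L_LF : LorentzFitzGerald c L) :
  (condM c L op <-> condAstar c op) /\ (condAstar c op <-> condR c L op).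
Proof.
have opc := velop_closed op_vel; have op0 := velop_id_l op_vel.
have A := condAstar_multiplicative c_gt0 opc.
have M := condM_multiplicative opc op0 L_LF.
have := condR_multiplicative L_fun opc L_LF.
tauto.
Qed.
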